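(* Let $y\in\mathcal Q_A\setminus\mathbb R$ and let $\mathrm P:\Sigma_A(y,R)\to A$ be a function defined by a power series $\mathrm P(x)=\sum_{n\in\mathbb N}(x-y)^{\cdot n}a_n$ (with $a_n\in A$) centered at $y$ with positive $\sigma_A$-radius of convergence $R$. Then, for each $n\in\mathbb N$, $$a_n=\frac1{n!}\,\partial_C^n\mathrm P(y).$$
   Context: Algebra. $A$ is a finite-dimensional real alternative algebra with unity $1$ (so $\mathbb R\subset A$), equipped with a real linear anti-involution $x\mapsto x^c$ (so $(x^c)^c=x$, $(xy)^c=y^cx^c$). Put $t(x):=x+x^c$, $n(x):=xx^c$. The quadratic cone is $\mathcal Q_A:=\mathbb R\cup\{x\in A: t(x)\in\mathbb R,\ n(x)\in\mathbb R,\ 4n(x)>t(x)^2\}$; $\mathbb S_A:=\{J\in\mathcal Q_A: J^2=-1\}$, assumed non-empty; $\mathbb C_J:=\mathbb R+\mathbb RJ$. One has $\mathcal Q_A=\bigcup_{J\in\mathbb S_A}\mathbb C_J$ and $\mathbb C_I\cap\mathbb C_J=\mathbb R$ if $I\ne\pm J$. $\mathrm{Re}(x):=(x+x^c)/2$, $\mathrm{Im}(x):=(x-x^c)/2$. $A$ is equipped with a norm $\|\cdot\|_A$ with $\|x\|_A=\sqrt{n(x)}$ for all $x\in\mathcal Q_A$. Power series. A map $F=F_1+iF_2:\mathbb C\to A\otimes_{\mathbb R}\mathbb C$ with $F_1(\bar z)=F_1(z)$, $F_2(\bar z)=-F_2(z)$ induces the slice function $\alpha+\beta J\mapsto F_1(\alpha+i\beta)+JF_2(\alpha+i\beta)$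 on $\mathcal Q_A$. $(x-y)^{\cdot n}a$ is the value at $x$ of the slice function induced by $z\mapsto(z-y)^na$. The $\sigma_A$-radius of convergence $R\in[0,+\infty]$ of $\sum_n(x-y)^{\cdot n}a_n$ is defined by $\limsup_n\|a_n\|_A^{1/n}=1/R$. Metric. For $y\in\mathbb C_J$: $\sigma_A(x,y):=\|x-y\|_A$ if $x\in\mathbb C_J$, and $\sigma_A(x,y):=\sqrt{|\mathrm{Re}(x)-\mathrm{Re}(y)|^2+(\|\mathrm{Im}(x)\|_A+\|\mathrm{Im}(y)\|_A)^2}$ otherwise. $\Sigma_A(y,R):=\{x\in\mathcal Q_A:\sigma_A(x,y)<R\}$. Cullen derivative. For $J\in\mathbb S_A$ put $\Phi_J(\alpha+i\beta):=\alpha+J\beta$ and $f_J:=f\circ\Phi_J$. At $y=\Phi_J(w)\notin\mathbb R$, $\partial_C^nf(y):=\frac{\partial^nf_J}{\partial z^n}(w)$, where $\frac{\partial}{\partial z}:=\frac12\big(\frac\partial{\partial\alpha}-J\cdot\frac\partial{\partial\beta}\big)$ (left multiplication by $J$). *)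

(* Defs.v *)
From HB Require Import structures.
From mathcomp Require Import all_boot all_order all_algebra.
From mathcomp Require Import all_classical all_reals all_analysis.

Set Implicit Arguments.
Unset Strict Implicit.
Unset Printing Implicit Defensive.

Import Order.TTheory GRing.Theory Num.Theory.
Import numFieldNormedType.Exports.

Local Open Scope classical_set_scope.
Local Open Scope ring_scope.

(* MathComp rings are associative, so the product of an alternative algebra   *)
(* is introduced separately. [NormedModule] only provides a vector space norm *)
(* (no submultiplicativity); [Vector] provides finite dimensionality.         *)
HB.mixin Record NormedModule_isAltStarAlgebra (R : realType) A
    of NormedModule R A & Vector R A := {
  aone : A;
  amul : A -> A -> A;
  aconj : A -> A;
  aone_neq0_subproof : aone != 0;
  amul1l_subproof : left_id aone amul;
  amul1r_subproof : right_id aone amul;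
  amulDl_subproof : left_distributive amul +%R;
  amulDr_subproof : right_distributive amul +%R;
  amulZl_subproof : forall (k : R) x y, amul (k *: x) y = k *: amul x y;
  amulZr_subproof : forall (k : R) x y, amul x (k *: y) = k *: amul x y;
  amul_altl_subproof : forall x y, amul x (amul x y) = amul (amul x x) y;
  amul_altr_subproof : forall x y, amul (amul y x) x = amul y (amul x x);
  aconjD_subproof : forall x y, aconj (x + y) = aconj x + aconj y;
  aconjZ_subproof : forall (k : R) x, aconj (k *: x) = k *: aconj x;
  aconjK_subproof : involutive aconj;
  aconjM_subproof : forall x y, aconj (amul x y) = amul (aconj y) (aconj x)
}.

#[short(type="altStarAlgType")]
HB.structure Definition AltStarAlgebra (R : realType) :=
  {A of NormedModule R A & Vector R A & NormedModule_isAltStarAlgebra R A}.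

Arguments aone {R s}.

Declare Scope alt_scope.
Delimit Scope alt_scope with alt.
Notation "x ** y" := (amul x y) (at level 40, left associativity) : alt_scope.
Notation "x ^c" := (aconj x) : alt_scope.
Local Open Scope alt_scope.

Section AltStar.
Variables (R : realType) (A : altStarAlgType R).
Implicit Types (x y a v J : A) (r s t : R) (n : nat).

(* The axioms are restated on the packed type so that they can be used as     *)
(* rewriting rules.                                                           *)
Lemma aone_neq0 : aone != 0 :> A. Proof. exact: aone_neq0_subproof. Qed.
Lemma amul1l : left_id aone (@amul R A). Proof. exact: amul1l_subproof. Qed.
Lemma amul1r : right_id aone (@amul R A). Proof. exact: amul1r_subproof. Qed.
Lemma amulDl : left_distributive (@amul R A) +%R.
Proof. exact: amulDl_subproof. Qed.
Lemma amulDr : right_distributive (@amul R A) +%R.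
Proof. exact: amulDr_subproof. Qed.
Lemma amulZl r x y : (r *: x) ** y = r *: (x ** y).
Proof. exact: amulZl_subproof. Qed.
Lemma amulZr r x y : x ** (r *: y) = r *: (x ** y).
Proof. exact: amulZr_subproof. Qed.
Lemma amul_altl x y : x ** (x ** y) = x ** x ** y.
Proof. exact: amul_altl_subproof. Qed.
Lemma amul_altr x y : y ** x ** x = y ** (x ** x).
Proof. exact: amul_altr_subproof. Qed.
Lemma aconjD x y : (x + y)^c = x^c + y^c. Proof. exact: aconjD_subproof. Qed.
Lemma aconjZ r x : (r *: x)^c = r *: x^c. Proof. exact: aconjZ_subproof. Qed.
Lemma aconjK : involutive (@aconj R A). Proof. exact: aconjK_subproof. Qed.
Lemma aconjM x y : (x ** y)^c = y^c ** x^c.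
Proof. exact: aconjM_subproof. Qed.

Definition areal r : A := r *: aone.

Definition is_real x := exists r, x = areal r.

Definition tr x : A := x + x^c.
Definition nm x : A := x ** x^c.

(* The quadratic cone Q_A *)
Definition qcone : set A := [set x | is_real x \/
  exists t s, [/\ tr x = areal t, nm x = areal s & t ^+ 2 < 4 * s]].

(* The set S_A of square roots of -1 in Q_A *)
Definition sphere : set A := [set J | qcone J /\ J ** J = - aone].

(* Complex numbers alpha + i beta are represented by pairs (alpha, beta). *)
Definition Phi J (z : R * R) : A := areal z.1 + z.2 *: J.

(* The complex slice C_J *)
Definition slice J : set A := range (Phi J).

Lemma areal_inj : injective areal.
Proof.
move=> r s; rewrite /areal => /eqP; rewrite -subr_eq0 -scalerBl scaler_eq0.
by rewrite (negbTE aone_neq0) orbF subr_eq0 => /eqP.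
Qed.

Lemma aconj1 : (aone : A)^c = aone.
Proof. by rewrite -[RHS]aconjK -[in RHS](amul1l (aone^c)) aconjM aconjK amul1l. Qed.

Lemma sphere_conj J : sphere J -> J^c = - J.
Proof.
case=> qJ JJ.
have Jnr : ~ is_real J.
  move=> [r rJ]; move: JJ; rewrite rJ /areal amulZl amulZr amul1l scalerA.
  move=> /eqP; rewrite -addr_eq0 -{2}(scale1r aone) -scalerDl scaler_eq0.
  rewrite (negbTE aone_neq0) orbF gt_eqF//.
  by rewrite ltr_wpDl// -expr2 sqr_ge0.
case: qJ => // -[t [s [trJ nmJ _]]].
have JcE : J^c = areal t - J by rewrite -trJ /tr addrC addKr.
move: nmJ; rewrite /nm JcE amulDr /areal amulZr amul1r.
rewrite -[- J]scaleN1r amulZr JJ !scaleN1r opprK => h.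
have [t0|t0] := eqVneq t 0; first by rewrite t0 scale0r sub0r.
case: Jnr; exists (t^-1 * (s - 1)); rewrite /areal -scalerA scalerBl -h scale1r.
by rewrite addrK scalerA mulVf// scale1r.
Qed.

Lemma Phi_eq J J' z z' : sphere J -> sphere J' -> Phi J z = Phi J' z' ->
  z'.1 = z.1 /\ [\/ J' = J /\ z'.2 = z.2, J' = - J /\ z'.2 = - z.2 |
                   z.2 = 0 /\ z'.2 = 0].
Proof.
case: z z' => [a b] [a' b'] sJ sJ' /=; rewrite /Phi /= => e.
have ec := congr1 (@aconj R A) e; move: ec.
rewrite !aconjD !aconjZ !aconj1 (sphere_conj sJ) (sphere_conj sJ') => ec.
have aa : a' = a.
  apply/areal_inj/(@scalerI _ _ (2 : R)); first by rewrite pnatr_eq0.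
  rewrite !scaler_nat !mulr2n; have := f_equal2 +%R e ec.
  by rewrite !scalerN addrACA subrr addr0 [in RHS]addrACA subrr addr0.
split=> //; move: e; rewrite aa => /addrI e.
have : b ^+ 2 = b' ^+ 2.
  have := f_equal2 (@amul R A) e e; rewrite !amulZl !amulZr sJ.2 sJ'.2 !scalerA.
  by rewrite !scalerN => /oppr_inj/areal_inj; rewrite !expr2.
move=> /eqP; rewrite eqf_sqr.
have [b0|b0] := eqVneq b 0.
  by rewrite b0 => h; apply: Or33; split=> //; move: h; rewrite ?[0 == - _]eq_sym
    ?oppr_eq0 [0 == _]eq_sym orbb => /eqP.
case/orP => /eqP bE; [apply: Or31|apply: Or32].
  by split=> //; apply/esym/(scalerI b0); rewrite e bE.
have b'E : b' = - b by rewrite bE opprK.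
by split=> //; apply/(scalerI b0); rewrite scalerN e b'E scaleNr opprK.
Qed.

Definition Rea x : A := 2^-1 *: (x + x^c).
Definition Ima x : A := 2^-1 *: (x - x^c).

Definition norm_compatible :=
  forall x, qcone x -> forall s, nm x = areal s -> `|x| = Num.sqrt s.

(* The complexification A (x) C: the pair (a, b) stands for a + i b. *)
Definition cmul (p q : A * A) : A * A :=
  (p.1 ** q.1 - p.2 ** q.2, p.1 ** q.2 + p.2 ** q.1).
Definition cexp (p : A * A) n : A * A := iter n (cmul p) (aone, 0).

(* z |-> (z - y)^n a, with z in R (x) C and y, a in A (x) 1 *)
Definition stem_pow y n a (z : R * R) : A * A :=
  cmul (cexp (areal z.1 - y, areal z.2) n) (a, 0).

(* The slice function induced by F = F_1 + i F_2. For a stem function F, that *)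
(* is F_1(z^* ) = F_1(z) and F_2(z^* ) = - F_2(z), its value at x does not    *)
(* depend on the choice of J and z such that x = Phi J z (see slice_funE).    *)
Definition slice_fun (F : R * R -> A * A) x : A :=
  xget 0 [set v | exists J z, [/\ sphere J, x = Phi J z &
                                  v = (F z).1 + J ** (F z).2]].

Lemma slice_funE (F : R * R -> A * A) J z :
    (forall u, (F (u.1, - u.2)).1 = (F u).1) ->
    (forall u, (F (u.1, - u.2)).2 = - (F u).2) ->
    sphere J ->
  slice_fun F (Phi J z) = (F z).1 + J ** (F z).2.
Proof.
move=> F1 F2 sJ; rewrite /slice_fun; case: xgetP => [v _|]; last first.
  by move=> /(_ ((F z).1 + J ** (F z).2)) []; exists J, z.
move=> [J' [z' [sJ' e ->]]]; have := Phi_eq sJ sJ' e.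
case: z z' {e} => [a b] [a' b'] /= [-> [[-> ->]|[-> ->]|[-> ->]]] //.
- rewrite (F1 (a, b)) (F2 (a, b)) /= -[- J]scaleN1r amulZl -[X in J ** X]scaleN1r.
  by rewrite amulZr scalerA mulrNN mulr1 scale1r.
- have : (F (a, 0)).2 = - (F (a, 0)).2 by rewrite -(F2 (a, 0)) /= oppr0.
  move=> /eqP; rewrite -subr_eq0 opprK -mulr2n -scaler_nat scaler_eq0 pnatr_eq0 /=.
  move=> /eqP ->; have am0 K : K ** 0 = 0 :> A.
    by rewrite -[X in K ** X](scale0r (0 : A)) amulZr scale0r.
  by rewrite !am0.
Qed.

(* (x - y)^{.n} a *)
Definition spow x y n a : A := slice_fun (stem_pow y n a) x.

(* The inverse of extended reals satisfies 0^-1 = +oo and +oo^-1 = 0. *)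
Definition sigma_radius (a : nat -> A) : \bar R :=
  ((limn_esup (fun n => (`|a n| `^ (n%:R^-1))%:E))^-1)%E.

(* |Re x - Re y| is computed in A, which is harmless as |1| = 1. *)
Definition sigma x y : R :=
  if `[< exists J, [/\ sphere J, slice J x & slice J y] >] then `|x - y|
  else Num.sqrt (`|Rea x - Rea y| ^+ 2 + (`|Ima x| + `|Ima y|) ^+ 2).

Definition sigma_ball y (r : \bar R) : set A :=
  [set x | qcone x /\ ((sigma x y)%:E < r)%E].

Definition d_alpha (g : R * R -> A) (z : R * R) : A :=
  derive1 (fun t => g (t, z.2)) z.1.
Definition d_beta (g : R * R -> A) (z : R * R) : A :=
  derive1 (fun t => g (z.1, t)) z.2.

(* (1/2) (d/dalpha - J d/dbeta) *)
Definition dz J (g : R * R -> A) (z : R * R) : A :=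
  2^-1 *: (d_alpha g z - J ** d_beta g z).

Definition dzn J n (g : R * R -> A) : R * R -> A := iter n (dz J) g.

(* Existence of the iterated derivative dzn J n g at z *)
Fixpoint dzn_exists J n (g : R * R -> A) (z : R * R) : Prop :=
  if n is m.+1 then
    [/\ \forall u \near z, dzn_exists J m g u,
        derivable (fun t => dzn J m g (t, z.2)) z.1 1 &
        derivable (fun t => dzn J m g (z.1, t)) z.2 1]
  else True.

(* At a non-real y in Q_A there are exactly two pairs (J, w) with             *)
(* y = Phi J w, exchanged by (J, w) |-> (- J, w^* ) (see Phi_eq), and both    *)
(* give the same derivative when it exists. Not meaningful for real y.        *)
Definition cullen_derive n (f : A -> A) y : A :=
  xget 0 [set v | exists J w, [/\ sphere J, y = Phi J w &
                                  v = dzn J n (f \o Phi J) w]].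

Definition cullen_derivable n (f : A -> A) y : Prop :=
  forall J w, sphere J -> y = Phi J w -> dzn_exists J n (f \o Phi J) w.

End AltStar.

(* Main.v *)
Require Import Defs.
From HB Require Import structures.
From mathcomp Require Import all_boot all_order all_algebra.
From mathcomp Require Import all_classical all_reals all_analysis.
From mathcomp Require Import complex ring.

Set Implicit Arguments.
Unset Strict Implicit.
Unset Printing Implicit Defensive.

Import Order.TTheory GRing.Theory Num.Theory.
Import numFieldNormedType.Exports VectorInternalTheory Normc.

Local Open Scope classical_set_scope.
Local Open Scope ring_scope.

(* Write y = Phi J w. By alternativity J (J a) = (J J) a = - a, so A is a     *)
(* complex vector space on which i acts as left multiplication by J, and for  *)
(* x = Phi J u the term (x - y)^{.n} a is just (u - w)^n a for this action.   *)
(* On the slice C_J the function P is therefore an ordinary power series in   *)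
(* u - w with vector coefficients. The norm of A need not be                  *)
(* submultiplicative, but finite dimension makes left multiplication by J     *)
(* bounded and A complete. The remainder estimate                             *)
(*   r^2 |(z + h)^n - z^n - n h z^(n-1)| <= n^2 |h|^2 r^n                     *)
(* then differentiates such a series term by term: its partial derivatives    *)
(* are S' and J S', so that its Cullen derivative is (S' - J (J S')) / 2 = S'.*)

(** Differentiating n times leaves the series with coefficients (n+k)!/k! a_(n+k), and at the centre
    only its constant term n! a_n survives: this is [dzn_csum_center]. Four facts lead there.
    [qcone_Phi] puts y on a slice C_J. [spow_Phi] identifies slice powers on C_J with complex powers
    acting on A. [sigma_radius_bounded] turns the positive radius of convergence into bounds |a_n|
    r^n <= M for every positive r below some r0 > 0, a condition that formal differentiation
    preserves. [csum_taylor] bounds the first-order remainder of the sum by K |h|^2, which gives the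
    partial derivatives in [csum_derivatives]. *)

(* This makes row vectors a completeNormedModType, which the library does not *)
(* declare although both parents are available.                               *)
HB.instance Definition _ (R : realType) m n := Complete.on 'M[R]_(m, n).

(** * Finite-dimensional normed spaces *)

Section FiniteDimension.
Variables (R : realType) (n : nat) (V : normedModType R).

Lemma rV_linearE (W : lmodType R) (f : {linear 'rV[R]_n -> W}) u :
  f u = \sum_i u ord0 i *: f (delta_mx ord0 i).
Proof.
rewrite {1}(row_sum_delta u) linear_sum; apply: eq_bigr => i _.
by rewrite linearZ.
Qed.

Lemma ler_coord_mx_norm (u : 'rV[R]_n) i : `|u ord0 i| <= `|u|.
Proof.
rewrite [leRHS]/Num.norm /= mx_normrE.
by apply/bigmax_geP; right => /=; exists (ord0, i).
Qed.

Lemma rV_linear_bounded (f : {linear 'rV[R]_n -> V}) :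
  exists2 C : R, 0 <= C & forall u, `|f u| <= C * `|u|.
Proof.
exists (\sum_i `|f (delta_mx ord0 i)|); first by apply: sumr_ge0.
move=> u; rewrite rV_linearE mulr_suml.
apply: (le_trans (ler_norm_sum _ _ _)); apply: ler_sum => i _.
by rewrite normrZ mulrC ler_wpM2l// ler_coord_mx_norm.
Qed.

Lemma rV_linear_continuous (f : {linear 'rV[R]_n -> V}) : continuous f.
Proof.
have [C C0 fC] := rV_linear_bounded f.
apply/bounded_linear_continuous/linear_boundedP.
near=> r => /= u; apply: (le_trans (fC u)); apply: ler_wpM2r => //.
Unshelve. all: by end_near. Qed.

(** By compactness |f u| attains a minimum on the unit sphere, positive because f is injective;
    homogeneity does the rest. *)
Lemma rV_linear_inj_lower_bound (f : {linear 'rV[R]_n -> V}) :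
  injective f -> exists2 C : R, 0 <= C & forall u, `|u| <= C * `|f u|.
Proof.
move=> f_inj; pose S := [set u : 'rV[R]_n | `|u| = 1].
have normalize u : u != 0 -> S (`|u|^-1 *: u).
  by move=> u0; rewrite /S /= normrZ normfV normr_id mulVf// normr_eq0.
have S_compact : compact S.
  apply: bounded_closed_compact.
    by exists 1; split=> // M M1 u /= ->; exact: ltW.
  apply: (@preimage_closed _ _ (fun u : 'rV[R]_n => `|u|) [set 1]).
    by move=> u _; exact: norm_continuous.
  exact: closed_eq.
(* The unit sphere is empty only in dimension 0, where every vector vanishes. *)
have [S0|S0] := pselect (S !=set0); last first.
  exists 0 => // u; have [->|/normalize Su] := eqVneq u 0.
    by rewrite normr0 mul0r.
  by case: S0; exists (`|u|^-1 *: u).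
have f_cont : {within S, continuous (fun u => `|f u|)}.
  apply: continuous_subspaceT => u.
  apply: (@continuous_comp _ _ _ f (fun x => `|x|)).
    exact: rV_linear_continuous.
  exact: norm_continuous.
have [u /set_mem Su um] := EVT_min_rV S0 S_compact f_cont.
have fu0 : 0 < `|f u|.
  rewrite normr_gt0; apply/eqP => fu0; move: Su.
  have -> : u = 0 by apply: f_inj; rewrite linear0.
  by rewrite /S /= normr0 => /esym/eqP; rewrite oner_eq0.
exists `|f u|^-1; first by rewrite invr_ge0 ltW.
move=> v; have [->|v0] := eqVneq v 0; first by rewrite normr0 linear0 normr0 mulr0.
have := um _ (mem_set (normalize _ v0)).
rewrite linearZ normrZ normfV normr_id ler_pdivlMl ?normr_gt0// => uv.
by rewrite ler_pdivlMl// mulrC.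
Qed.
End FiniteDimension.

Section AltStarNorm.
Variables (R : realType) (A : altStarAlgType R).

Lemma vect_coord_bounded :
  exists2 C : R, 0 <= C & forall x : A, `|v2r x : 'rV[R]__| <= C * `|x|.
Proof.
have r2v_inj : injective (@r2v R A) by exact: can_inj r2vK.
have [C C0 hC] := rV_linear_inj_lower_bound r2v_inj.
by exists C => // x; rewrite -{2}(v2rK x).
Qed.

Lemma vect_linear_bounded (V : normedModType R) (f : {linear A -> V}) :
  exists2 C : R, 0 <= C & forall x, `|f x| <= C * `|x|.
Proof.
have [C C0 hC] := vect_coord_bounded.
have [D D0 hD] := rV_linear_bounded (f \o r2v).
exists (D * C); first exact: mulr_ge0.
move=> x; rewrite -{1}(v2rK x) -mulrA; apply: (le_trans (hD _)).
exact: ler_wpM2l.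
Qed.

(** Completeness is borrowed from row vectors: the coordinates converge absolutely there, and [r2v]
    carries the limit back. *)
Lemma vect_normed_cvg (u : A^nat) :
  cvgn (series (fun n => `|u n|)) -> cvgn (series u).
Proof.
move=> u_cvg; have [C C0 hC] := vect_coord_bounded.
have : cvgn (series (fun n => v2r (u n))).
  apply: normed_cvg; apply: (@series_le_cvg _ _ (fun n => C * `|u n|)) => [n|n|n|].
  - exact: normr_ge0.
  - exact: mulr_ge0.
  - exact: hC.
  - exact: is_cvg_seriesZ.
move=> /cvg_ex[l ul]; apply/cvg_ex; exists (r2v l).
have -> : series u = r2v \o series (fun n => v2r (u n)).
  apply/funext => n; rewrite /series /= linear_sum.
  apply: eq_bigr => i _; exact/esym/v2rK.
apply: cvg_comp ul _; exact: rV_linear_continuous.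
Qed.
End AltStarNorm.

(** * Geometrically bounded coefficients *)

Section NormC.
Variable R : rcfType.
Implicit Types z h : R[i].

Lemma normc_ge0 z : 0 <= normc z.
Proof. by case: z => x y; exact: sqrtr_ge0. Qed.

Lemma normcX z n : normc (z ^+ n) = normc z ^+ n.
Proof. by elim: n => [|n IH]; rewrite ?expr0 ?normc1// !exprS normcM IH. Qed.

Lemma normc_real (t : R) : normc t%:C%C = `|t|.
Proof. by rewrite /normc /= expr0n/= addr0 sqrtr_sqr. Qed.

Lemma normc_i (t : R) : normc (t *i)%C = `|t|.
Proof. by rewrite /normc /= expr0n/= add0r sqrtr_sqr. Qed.

Lemma normc_Re z : `|complex.Re z| <= normc z.
Proof.
case: z => x y /=; rewrite -sqrtr_sqr; apply: ler_wsqrtr.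
by rewrite lerDl sqr_ge0.
Qed.

Lemma normc_Im z : `|complex.Im z| <= normc z.
Proof.
case: z => x y /=; rewrite -sqrtr_sqr; apply: ler_wsqrtr.
by rewrite lerDr sqr_ge0.
Qed.

(** The factor r^2 avoids both a division and the exponent n - 1. The remainders satisfy D_(n+1) =
    (z + h) D_n + (n+1) h^2 z^n. *)
Lemma normc_taylor1 r z h n : normc z <= r -> normc (z + h) <= r ->
  r ^+ 2 * normc ((z + h) ^+ n.+1 - z ^+ n.+1 - n.+1%:R * (h * z ^+ n))
    <= n.+1%:R ^+ 2 * normc h ^+ 2 * r ^+ n.+1.
Proof.
move=> zr zhr; have r0 : 0 <= r := le_trans (normc_ge0 z) zr.
elim: n => [|n IH].
  have -> : (z + h) ^+ 1 - z ^+ 1 - 1%:R * (h * z ^+ 0) = 0 by ring.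
  by rewrite normc0 mulr0 !mulr_ge0// ?exprn_ge0// normc_ge0.
have -> : (z + h) ^+ n.+2 - z ^+ n.+2 - n.+2%:R * (h * z ^+ n.+1) =
    (z + h) * ((z + h) ^+ n.+1 - z ^+ n.+1 - n.+1%:R * (h * z ^+ n)) +
    h ^+ 2 * z ^+ n *+ n.+1.
  by rewrite -(natr1 n.+1) -mulr_natr !exprS; ring.
have := le_normcD ((z + h) *
    ((z + h) ^+ n.+1 - z ^+ n.+1 - n.+1%:R * (h * z ^+ n)))
  (h ^+ 2 * z ^+ n *+ n.+1).
rewrite normcMn !normcM !normcX; set D := normc (_ - _ - _) in IH * => leD.
have hz : normc h ^+ 2 * normc z ^+ n <= normc h ^+ 2 * r ^+ n.
  by rewrite ler_wpM2l ?exprn_ge0 ?normc_ge0// lerXn2r ?nnegrE ?normc_ge0.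
have zD : normc (z + h) * D <= r * D by rewrite ler_wpM2r// normc_ge0.
have hr0 : 0 <= normc h ^+ 2 * r ^+ n by rewrite mulr_ge0 ?exprn_ge0 ?normc_ge0.
apply: (@le_trans _ _ (r ^+ 2 * (r * D + normc h ^+ 2 * r ^+ n *+ n.+1))).
  rewrite ler_wpM2l ?exprn_ge0//; apply: (le_trans leD).
  by rewrite lerD// lerMn2r hz orbT.
rewrite mulrDr mulrCA.
apply: (@le_trans _ _ (r * (n.+1%:R ^+ 2 * normc h ^+ 2 * r ^+ n.+1) +
   r ^+ 2 * (normc h ^+ 2 * r ^+ n *+ n.+1))).
  by rewrite lerD2r ler_wpM2l.
(* The slack comes from (n+2)^2 = (n+1)^2 + (n+1) + (n+2). *)
have -> : n.+2%:R ^+ 2 * normc h ^+ 2 * r ^+ n.+2 =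
   r * (n.+1%:R ^+ 2 * normc h ^+ 2 * r ^+ n.+1) +
   r ^+ 2 * (normc h ^+ 2 * r ^+ n *+ n.+1) +
   r ^+ 2 * (normc h ^+ 2 * r ^+ n) * n.+2%:R.
  by rewrite -(natr1 n.+1) -mulr_natr !exprS; ring.
by rewrite lerDl; apply: mulr_ge0 => //; apply: mulr_ge0 => //; exact: exprn_ge0.
Qed.
End NormC.

Lemma exists_between (R : realFieldType) (x y : R) : x < y ->
  exists2 z, x < z & z < y.
Proof. by move=> /midf_lt[? ?]; exists ((x + y) / 2). Qed.

(** * Coefficient bounds and their stability under differentiation *)

Section GeometricBound.
Variables (R : realType) (V : normedModType R).
Implicit Types (b : V^nat) (r rho : R).

(** Abel's condition. Unlike convergence at radius rho, it passes to n b_n by a plain estimate once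
    rho is decreased. *)
Definition geometrically_bounded rho b :=
  exists M, forall n, `|b n| * rho ^+ n <= M.

Definition deriv_coef b : V^nat := fun n => n.+1%:R *: b n.+1.

Lemma geometric_sum_le (a q : R) n : 0 <= a -> 0 < q < 1 ->
  \sum_(0 <= i < n) a * q ^+ i <= a / (1 - q).
Proof.
move=> a0 /andP[q0 q1]; apply: (@geometric_le_lim R n a q) => //.
by rewrite ger0_norm// ltW.
Qed.

(** Each of the n terms of the sum of q^i for i < n is at least q^n. *)
Lemma natmul_geometric_le (q : R) n : 0 < q < 1 -> n%:R * q ^+ n <= (1 - q)^-1.
Proof.
move=> q01; have := @geometric_sum_le 1 q n ler01 q01; rewrite mul1r.
apply: le_trans; rewrite mulr_natl -[X in _ *+ X](subn0 n) -sumr_const_nat.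
have /andP[q0 q1] := q01.
apply: ler_sum_nat => i /andP[_ ni]; rewrite mul1r.
by apply: ler_wiXn2l; rewrite ?ltW// ltnW.
Qed.

Lemma geometrically_bounded_ler r rho b M : 0 < r < rho ->
    (forall n, `|b n| * rho ^+ n <= M) ->
  forall n, `|b n| * r ^+ n <= M * (r / rho) ^+ n.
Proof.
move=> /andP[r0 rrho] bM n; have rho0 : 0 < rho := lt_trans r0 rrho.
rewrite expr_div_n mulrA [leRHS]mulrAC ler_wpM2r ?exprn_ge0 ?(ltW r0)//.
by rewrite ler_pdivlMr ?exprn_gt0.
Qed.

Lemma ratio_lt1 r rho : 0 < r < rho -> 0 < r / rho < 1.
Proof.
move=> /andP[r0 rrho]; have rho0 : 0 < rho := lt_trans r0 rrho.
by rewrite divr_gt0//= ltr_pdivrMr// mul1r.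
Qed.

Lemma geometrically_bounded_ge0 rho b M :
  (forall n, `|b n| * rho ^+ n <= M) -> 0 <= M.
Proof. by move=> /(_ 0); rewrite expr0 mulr1; apply: le_trans. Qed.

Lemma geometrically_bounded_natmul r rho b : 0 < r < rho ->
  geometrically_bounded rho b ->
  geometrically_bounded r (fun n => n%:R *: b n).
Proof.
move=> r_rho [M bM]; exists (M / (1 - r / rho)) => n.
rewrite normrZ normr_nat -mulrA.
apply: (@le_trans _ _ (n%:R * (M * (r / rho) ^+ n))).
  by rewrite ler_wpM2l// geometrically_bounded_ler.
rewrite mulrCA ler_wpM2l ?(geometrically_bounded_ge0 bM)//.
exact/natmul_geometric_le/ratio_lt1.
Qed.

Lemma geometrically_bounded_deriv r rho b : 0 < r < rho ->
  geometrically_bounded rho b -> geometrically_bounded r (deriv_coef b).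
Proof.
move=> r_rho /(geometrically_bounded_natmul r_rho)[M bM].
have /andP[r0 _] := r_rho; exists (M / r) => n.
by rewrite ler_pdivlMr// -mulrA -exprSr; exact: (bM n.+1).
Qed.

Lemma geometrically_bounded_sum r rho b : 0 < r < rho ->
  geometrically_bounded rho b ->
  exists2 K : R, 0 <= K & forall n, \sum_(0 <= i < n) `|b i| * r ^+ i <= K.
Proof.
move=> r_rho [M bM]; have M0 := geometrically_bounded_ge0 bM.
have q01 := ratio_lt1 r_rho; have /andP[_ q1] := q01.
exists (M / (1 - r / rho)); first by rewrite divr_ge0// subr_ge0 ltW.
move=> n; apply: le_trans (geometric_sum_le n M0 q01).
by apply: ler_sum => i _; exact: geometrically_bounded_ler.
Qed.

(** Asking for all radii below r0 absorbs the loss of radius at each differentiation, so that r0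
    itself never changes. *)
Definition geometrically_bounded_below r0 b :=
  forall r, 0 < r < r0 -> geometrically_bounded r b.

Lemma geometrically_bounded_below_deriv r0 b :
  geometrically_bounded_below r0 b ->
  geometrically_bounded_below r0 (deriv_coef b).
Proof.
move=> bb r /andP[rgt0 rr0].
have [s rs sr0] := exists_between rr0.
apply: (@geometrically_bounded_deriv _ s); first by rewrite rgt0.
by apply: bb; rewrite (lt_trans rgt0)/=.
Qed.

Lemma is_derive_quadratic (f : R -> V) (t d K : R) (D : V) : 0 < d ->
    (forall h, `|h| < d -> `|f (t + h) - f t - h *: D| <= K * h ^+ 2) ->
  is_derive t 1 f D.
Proof.
move=> d0 fD.
suff h : (fun h => h^-1 *: ((f \o shift t) (h *: 1) - f t)) @ 0^' --> D.
  by apply: DeriveDef; [apply/cvg_ex; exists D|exact: cvg_lim].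
apply/cvgrPdist_le => e e0.
(* [K] may have any sign; [|K| + 1] is a positive number above it. *)
have K1 : 0 < `|K| + 1 by rewrite ltr_wpDl.
near=> h.
have h0 : h != 0 by near: h; exact: nbhs_dnbhs_neq.
have hd : `|h| < d by near: h; apply: dnbhs0_lt.
have he : `|h| < e / (`|K| + 1) by near: h; apply: dnbhs0_lt; exact: divr_gt0.
have -> : D - h^-1 *: ((f \o shift t) (h *: 1) - f t) =
   - (h^-1 *: (f (t + h) - f t - h *: D)).
  rewrite /= -[h *: 1]/(h * 1) mulr1 (addrC h t) [in RHS]scalerBr scalerA mulVf//.
  by rewrite scale1r opprB.
rewrite normrN normrZ normfV ler_pdivrMl ?normr_gt0//.
apply: (le_trans (fD _ hd)); rewrite -real_normK ?num_real// expr2 mulrCA.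
rewrite ler_wpM2l//; move: he; rewrite ltr_pdivlMr// => /ltW.
apply: le_trans; rewrite mulrC ler_wpM2l//.
by apply: (le_trans (ler_norm _)); rewrite lerDl.
Unshelve. all: by end_near. Qed.
End GeometricBound.

Local Open Scope alt_scope.

(** * Power series for the complex action of [J] *)

Section ComplexAction.
Variables (R : realType) (A : altStarAlgType R) (J : A).
Hypothesis J_sphere : sphere J.
Implicit Types (x y : A) (z h : R[i]) (b : A^nat).

Lemma amul_linear x : linear (amul x).
Proof. by move=> k y z; rewrite amulDr amulZr. Qed.

HB.instance Definition _ x :=
  GRing.isLinear.Build R A A *:%R (amul x) (amul_linear x).

Lemma sphere_mulK x : J ** (J ** x) = - x.
Proof.
rewrite amul_altl J_sphere.2 -[- aone]scaleN1r amulZl amul1l.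
by rewrite scaleN1r.
Qed.

Definition cact z x : A := complex.Re z *: x + complex.Im z *: (J ** x).

Lemma cact_linear z : linear (cact z).
Proof.
move=> k x y; rewrite /cact amulDr amulZr !scalerDr !scalerA !(mulrC k).
by rewrite addrACA.
Qed.

HB.instance Definition _ z :=
  GRing.isLinear.Build R A A *:%R (cact z) (cact_linear z).

Lemma cactDl z h x : cact (z + h) x = cact z x + cact h x.
Proof. by case: z h => [p q] [s t]; rewrite /cact /= !scalerDl addrACA. Qed.

Lemma cactBl z h x : cact (z - h) x = cact z x - cact h x.
Proof.
by case: z h => [p q] [s t]; rewrite /cact /= !scalerBl opprD addrACA.
Qed.

(** Both scalars act through the same [J], so the only reassociation is J (J x) = - x. *)
Lemma cactM z h x : cact (z * h) x = cact z (cact h x).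
Proof.
case: z h => [p q] [s t]; rewrite /cact /= amulDr !amulZr sphere_mulK.
rewrite scalerBl scalerDl !scalerDr !scalerN !scalerA.
by rewrite addrACA [in RHS]addrACA [- _ + _]addrC -!addrA; congr (_ + _); rewrite addrCA.
Qed.

Lemma cact1 x : cact 1 x = x.
Proof. by rewrite /cact /= scale1r scale0r addr0. Qed.

Lemma cact_real (t : R) x : cact t%:C%C x = t *: x.
Proof. by rewrite /cact /= scale0r addr0. Qed.

Lemma cact_i (t : R) x : cact (t *i)%C x = t *: (J ** x).
Proof. by rewrite /cact /= scale0r add0r. Qed.

Lemma cact_nat n x : cact n%:R x = n%:R *: x.
Proof. by rewrite -cact_real rmorph_nat. Qed.

(** Stands in for submultiplicativity of the norm in all estimates below. *)
Lemma cact_bounded :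
  exists2 C : R, 0 <= C & forall z x, `|cact z x| <= C * normc z * `|x|.
Proof.
have [C C0 hC] := vect_linear_bounded (amul J).
exists (1 + C); first by rewrite addr_ge0.
move=> z x; apply: (le_trans (ler_normD _ _)); rewrite !normrZ.
rewrite !mulrDl mul1r lerD ?ler_wpM2r ?normc_Re//.
by rewrite [C * _]mulrC -mulrA ler_pM ?normc_Im//; exact: hC.
Qed.

Lemma cact_continuous z : continuous (cact z).
Proof.
have [C C0 hC] := vect_linear_bounded (cact z).
apply/bounded_linear_continuous/linear_boundedP.
near=> r => /= x; apply: (le_trans (hC x)); exact: ler_wpM2r.
Unshelve. all: by end_near. Qed.

Definition cseries b z : A^nat := series (fun n => cact (z ^+ n) (b n)).

Definition csum b z : A := limn (cseries b z).

Lemma is_cvg_cseries r0 b z : geometrically_bounded_below r0 b ->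
  normc z < r0 -> cvgn (cseries b z).
Proof.
move=> bb zr0; apply: vect_normed_cvg.
have [C C0 hC] := cact_bounded.
(* Taking r strictly above |z| keeps it positive even for z = 0; comparison is with the geometric
   series of ratio r / rho. *)
have [r zr rr0] := exists_between zr0.
have r_gt0 : 0 < r := le_lt_trans (normc_ge0 z) zr.
have [rho rrho rhor0] := exists_between rr0.
have [|M bM] := bb rho; first by rewrite rhor0 (lt_trans r_gt0).
have r_rho : 0 < r < rho by rewrite r_gt0.
have /andP[q0 q1] := ratio_lt1 r_rho.
apply: (@series_le_cvg _ _ (geometric (C * M) (r / rho))) => [n|n|n|].
- exact: normr_ge0.
- by rewrite /= !mulr_ge0 ?exprn_ge0 ?(ltW q0) ?(geometrically_bounded_ge0 bM).
- rewrite /=; apply: le_trans (hC _ _) _; rewrite -!mulrA ler_wpM2l//.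
  apply: le_trans (geometrically_bounded_ler r_rho bM n).
  by rewrite mulrC ler_wpM2l// normcX lerXn2r ?nnegrE ?normc_ge0// ltW.
- by apply: is_cvg_geometric_series; rewrite gtr0_norm.
Qed.

(** The constant term cancels in the difference, so n + 1 terms of the series face n terms of its
    derivative. *)
Lemma cseries_taylor b z h n :
  cseries b (z + h) n.+1 - cseries b z n.+1
    - cact h (cseries (deriv_coef b) z n) =
  \sum_(0 <= i < n) cact ((z + h) ^+ i.+1 - z ^+ i.+1
    - i.+1%:R * (h * z ^+ i)) (b i.+1).
Proof.
rewrite /cseries /series /= !big_nat_recl//= !expr0 opprD addrACA subrr add0r.
rewrite (linear_sum (cact h)) /= -!sumrB; apply: eq_bigr => i _.
rewrite !cactBl; congr (_ - _); rewrite /deriv_coef !cactM.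
by rewrite cact_nat !linearZ.
Qed.

(** The remainders of the partial sums are bounded uniformly in n by [normc_taylor1], and the bound
    passes to the limit. *)
Lemma csum_taylor r0 b z : geometrically_bounded_below r0 b -> normc z < r0 ->
  exists K d, 0 < d /\ forall h, normc h < d ->
    `|csum b (z + h) - csum b z - cact h (csum (deriv_coef b) z)|
      <= K * normc h ^+ 2.
Proof.
move=> bb zr0; have [C C0 hC] := cact_bounded.
have [r zr rr0] := exists_between zr0.
have r_gt0 : 0 < r := le_lt_trans (normc_ge0 z) zr.
have [s rs sr0] := exists_between rr0.
have s_gt0 : 0 < s := lt_trans r_gt0 rs.
(* Radii r < s < t < u < r0: each of the two factors i + 1 costs one step, and summation costs the
   third. *)
have [K K0 hK] : exists2 K : R, 0 <= K & forall n,
    \sum_(0 <= i < n) i.+1%:R ^+ 2 * `|b i.+1| * r ^+ i.+1 <= K.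
  have [t st tr0] := exists_between sr0.
  have t_gt0 : 0 < t := lt_trans s_gt0 st.
  have [u tu ur0] := exists_between tr0.
  have bu : geometrically_bounded u b.
    by apply: bb; rewrite ur0 andbT (lt_trans t_gt0).
  have tu' : 0 < t < u by rewrite t_gt0.
  have st' : 0 < s < t by rewrite s_gt0.
  have rs' : 0 < r < s by rewrite r_gt0.
  have [K K0 hK] := geometrically_bounded_sum rs'
    (geometrically_bounded_natmul st' (geometrically_bounded_natmul tu' bu)).
  exists K => // n; apply: le_trans (hK n.+1).
  rewrite big_nat_recl//= scale0r normr0 mul0r add0r.
  apply: ler_sum => i _; rewrite !normrZ !normr_nat mulrA expr2.
  exact: lexx.
(* With this d, z + h stays in the disc of radius r. *)
exists (C * K / r ^+ 2), (r - normc z); split; first by rewrite subr_gt0.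
move=> h; rewrite ltrBrDl => zhr.
have zh : normc (z + h) < r := le_lt_trans (le_normcD z h) zhr.
have cvg_b u : normc u < r -> cseries b u n.+1 @[n --> \oo] --> csum b u.
  move=> ur; have := is_cvg_cseries bb (lt_trans ur rr0).
  by rewrite -(cvg_shiftS (cseries b u)).
have cvg_b' : cact h (cseries (deriv_coef b) z n) @[n --> \oo]
    --> cact h (csum (deriv_coef b) z).
  apply: continuous_cvg; first exact: cact_continuous.
  by apply: is_cvg_cseries zr0; exact: geometrically_bounded_below_deriv.
have cvg_rem : `|cseries b (z + h) n.+1 - cseries b z n.+1
    - cact h (cseries (deriv_coef b) z n)| @[n --> \oo] -->
    `|csum b (z + h) - csum b z - cact h (csum (deriv_coef b) z)|.
  by apply: cvg_norm; apply: cvgB cvg_b'; apply: cvgB; exact: cvg_b.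
rewrite -(cvg_lim _ cvg_rem)//; apply: limr_le; first exact: cvgP cvg_rem.
near=> n; rewrite cseries_taylor.
apply: (le_trans (ler_norm_sum _ _ _)).
have c0 : 0 <= C * normc h ^+ 2 / r ^+ 2.
  by rewrite !mulr_ge0 ?invr_ge0 ?exprn_ge0 ?normc_ge0// ltW.
have -> : C * K / r ^+ 2 * normc h ^+ 2 = C * normc h ^+ 2 / r ^+ 2 * K by ring.
apply: le_trans (ler_wpM2l c0 (hK n)); rewrite mulr_sumr.
apply: ler_sum => i _; apply: le_trans (hC _ _) _.
have := normc_taylor1 i (ltW zr) (ltW zh).
rewrite -ler_pdivlMl ?exprn_gt0// => hD.
apply: le_trans (ler_wpM2r _ (ler_wpM2l C0 hD)) _ => //.
by rewrite le_eqVlt; apply/orP; left; apply/eqP; ring.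
Unshelve. all: by end_near. Qed.
End ComplexAction.

(** * Termwise differentiation along a slice *)

Section Termwise.
Variables (R : realType) (A : altStarAlgType R) (J : A).
Hypothesis J_sphere : sphere J.
Implicit Types (b : A^nat) (g : R * R -> A) (u : R * R) (c : R[i]).

Definition cplx u : R[i] := Complex u.1 u.2.

(** Half of the gap to r0 is allotted to each coordinate. *)
Lemma near_disc (r0 : R) c u : normc (cplx u - c) < r0 ->
  \forall v \near u, normc (cplx v - c) < r0.
Proof.
move=> ur0; pose e := (r0 - normc (cplx u - c)) / 2.
have e0 : 0 < e by rewrite divr_gt0// subr_gt0.
have cplxE v : cplx v - c =
    (cplx u - c) + ((v.1 - u.1)%:C%C + ((v.2 - u.2) *i)%C).
  case: c {ur0 e e0} => c1 c2; apply/eqP; rewrite eq_complex /=.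
  by apply/andP; split; apply/eqP; ring.
have r0E : normc (cplx u - c) + (e + e) = r0.
  by rewrite /e -splitr addrC subrK.
have near_fst : \forall v \near u, `|v.1 - u.1| < e.
  exists (ball u.1 e, setT) => /=.
    by split; [exact: nbhsx_ballx|exact: filterT].
  by move=> v [/= + _]; rewrite -ball_normE /ball_ /= distrC.
have near_snd : \forall v \near u, `|v.2 - u.2| < e.
  exists (setT, ball u.2 e) => /=.
    by split; [exact: filterT|exact: nbhsx_ballx].
  by move=> v [/= _]; rewrite -ball_normE /ball_ /= distrC.
apply: filterS2 near_fst near_snd => v v1 v2; rewrite cplxE -r0E.
apply: le_lt_trans (le_normcD _ _) _; rewrite ltrD2l.
by apply: le_lt_trans (le_normcD _ _) _; rewrite normc_real normc_i ltrD.
Qed.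

Lemma csum_derivatives (r0 : R) b c u g : geometrically_bounded_below r0 b ->
    normc (cplx u - c) < r0 ->
    (\forall v \near u, g v = csum J b (cplx v - c)) ->
  [/\ derivable (fun t => g (t, u.2)) u.1 1,
      derivable (fun t => g (u.1, t)) u.2 1 &
      dz J g u = csum J (deriv_coef b) (cplx u - c)].
Proof.
move=> bb ur0 gE; set D := csum J (deriv_coef b) (cplx u - c).
have [K [d [d0 hK]]] := csum_taylor J_sphere bb ur0.
have d1 : is_derive u.1 (1 : R) (fun t => g (t, u.2)) D.
  apply: (@near_eq_is_derive _ _ _ (fun t => csum J b (cplx (t, u.2) - c))).
    have u_cvg : (t, u.2) @[t --> u.1] --> u.
      by rewrite {2}[u]surjective_pairing; apply: (@cvg_pair _ _ _ _ (nbhs u.1) (nbhs u.2)) => //; exact: cvg_cst.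
    have gE' : \forall t \near u.1, g (t, u.2) = csum J b (cplx (t, u.2) - c) := u_cvg _ gE.
    by apply: filterS gE' => t ->.
  apply: (@is_derive_quadratic _ _ _ _ d K) => // h hd.
  have := hK h%:C%C; rewrite normc_real => /(_ hd).
  rewrite cact_real (real_normK (num_real h)).
  have -> : cplx u - c + h%:C%C = cplx (u.1 + h, u.2) - c.
    rewrite addrAC; congr (_ - _); apply/eqP; rewrite eq_complex /=.
    by rewrite addr0 !eqxx.
  by rewrite -surjective_pairing.
(* An increment h of the second coordinate is the complex increment i h, which acts on D as h J. *)
have d2 : is_derive u.2 (1 : R) (fun t => g (u.1, t)) (J ** D).
  apply: (@near_eq_is_derive _ _ _ (fun t => csum J b (cplx (u.1, t) - c))).
    have u_cvg : (u.1, t) @[t --> u.2] --> u.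
      by rewrite {2}[u]surjective_pairing; apply: (@cvg_pair _ _ _ _ (nbhs u.1) (nbhs u.2)) => //; exact: cvg_cst.
    have gE' : \forall t \near u.2, g (u.1, t) = csum J b (cplx (u.1, t) - c) := u_cvg _ gE.
    by apply: filterS gE' => t ->.
  apply: (@is_derive_quadratic _ _ _ _ d K) => // h hd.
  have := hK (h *i)%C; rewrite normc_i => /(_ hd).
  rewrite cact_i (real_normK (num_real h)).
  have -> : cplx u - c + (h *i)%C = cplx (u.1, u.2 + h) - c.
    rewrite addrAC; congr (_ - _); apply/eqP; rewrite eq_complex /=.
    by rewrite addr0 !eqxx.
  by rewrite -surjective_pairing.
have [d1_ex d1E] := d1; have [d2_ex d2E] := d2; split=> //.
rewrite /dz /d_alpha /d_beta !derive1E d1E d2E.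
rewrite sphere_mulK// opprK -mulr2n -[D *+ 2]scaler_nat scalerA.
by rewrite mulVf ?pnatr_eq0// scale1r.
Qed.

(** Existence and value are proved together on the whole disc, because each order of [dzn_exists]
    requires the previous one in a neighbourhood. *)
Lemma dzn_csum (r0 : R) b c g n u : geometrically_bounded_below r0 b ->
    (forall v, normc (cplx v - c) < r0 -> g v = csum J b (cplx v - c)) ->
    normc (cplx u - c) < r0 ->
  dzn_exists J n g u /\
  dzn J n g u = csum J (iter n (@deriv_coef _ _) b) (cplx u - c).
Proof.
move=> bb gE; elim: n u => [|n IH] u ur0; first by split=> //; exact: gE.
have bbn : geometrically_bounded_below r0 (iter n (@deriv_coef _ _) b).
  elim: n {IH} => //= n IH; exact: geometrically_bounded_below_deriv.
have [|d1 d2 dzE] := csum_derivatives (g := dzn J n g) bbn ur0.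
  by apply: filterS (near_disc ur0) => v vr0; have [_] := IH _ vr0.
split=> //=; split=> //.
by apply: filterS (near_disc ur0) => v vr0; have [] := IH _ vr0.
Qed.

Lemma csum0 b : csum J b 0 = b 0.
Proof.
(* The partial sums equal [b 0] only from index 1 on, hence the shift. *)
apply: cvg_lim => //; rewrite -(cvg_shiftS (cseries J b 0)).
apply: (@cvg_trans _ (b 0 @[_ --> \oo])); last exact: cvg_cst.
apply: near_eq_cvg; near=> n; rewrite /cseries /series /=.
rewrite big_nat_recl//= expr0 cact1 big1 ?addr0// => i _.
by rewrite expr0n/= /cact /= !scale0r addr0.
Unshelve. all: by end_near. Qed.

(** Keeping k! on the left avoids quotients of factorials; the centre needs k = 0. *)
Lemma iter_deriv_coef b n k :
  k`!%:R *: iter n (@deriv_coef _ _) b k = (n + k)`!%:R *: b (n + k)%N.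
Proof.
elim: n k => // n IH k; rewrite iterS /deriv_coef scalerA -natrM mulnC -factS.
by rewrite IH addSnnS.
Qed.

Lemma dzn_csum_center (r0 : R) b c g n : 0 < r0 ->
    geometrically_bounded_below r0 b ->
    (forall v, normc (cplx v - c) < r0 -> g v = csum J b (cplx v - c)) ->
  forall u, cplx u = c -> dzn J n g u = n`!%:R *: b n.
Proof.
move=> r0_gt0 bb gE u uc; have uc0 : cplx u - c = 0 by rewrite uc subrr.
have [|_ ->] := @dzn_csum r0 b c g n u bb gE; first by rewrite uc0 normc0.
by rewrite uc0 csum0 -[LHS]scale1r -[1]/(0`!%:R) iter_deriv_coef addn0.
Qed.
End Termwise.

(** * Slice powers *)

Section SlicePower.
Variables (R : realType) (A : altStarAlgType R).
Implicit Types (x y a p q : A) (u w : R * R).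

Lemma amulNl x y : (- x) ** y = - (x ** y).
Proof. by rewrite -scaleN1r amulZl scaleN1r. Qed.

Lemma amulNr x y : x ** (- y) = - (x ** y).
Proof. exact: raddfN. Qed.

Lemma amul0r x : x ** 0 = 0.
Proof. exact: raddf0. Qed.

Lemma aconjN x : (- x)^c = - x^c.
Proof. by rewrite -scaleN1r aconjZ scaleN1r. Qed.

Lemma cexp_conj p q n :
  cexp (p, - q) n = ((cexp (p, q) n).1, - (cexp (p, q) n).2).
Proof.
elim: n => [|n]; rewrite /cexp /= ?oppr0// => ->.
by rewrite /cmul /= !(amulNl, amulNr) opprK opprD.
Qed.

(** The parity that [slice_funE] requires of a stem function. *)
Lemma stem_pow_conj y n a u :
  stem_pow y n a (u.1, - u.2) =
  ((stem_pow y n a u).1, - (stem_pow y n a u).2).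
Proof.
rewrite /stem_pow /= /areal scaleNr cexp_conj /cmul /= !amulNl opprD.
by rewrite !amul0r !(oppr0, addr0, add0r).
Qed.

Variable J : A.
Hypothesis J_sphere : sphere J.

Lemma PhiE u : Phi J u = cact J (cplx u) aone.
Proof. by rewrite /cact /= amul1r. Qed.

Lemma cact_amul (z : R[i]) x : cact J z aone ** x = cact J z x.
Proof. by rewrite /cact amulDl !amulZl amul1l amul1r. Qed.

(** Powers of elements of C_J + i C_J stay there, and (P, Q) |-> P + i Q, which identifies the two
    imaginary units, is multiplicative. Only this combination of [Pn] and [Qn] matters later. *)
Lemma cexp_cact (P Q : R[i]) n : exists Pn Qn : R[i],
  cexp (cact J P aone, cact J Q aone) n = (cact J Pn aone, cact J Qn aone) /\
  Pn + 'i%C * Qn = (P + 'i%C * Q) ^+ n.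
Proof.
elim: n => [|n [Pn [Qn [IH PQn]]]].
  exists 1, 0; rewrite cact1 mulr0 addr0; split=> //.
  by rewrite /cact /= !scale0r addr0.
exists (P * Pn - Q * Qn), (P * Qn + Q * Pn); split.
  have cmulE (x y v w : A) :
    cmul (x, y) (v, w) = (x ** v - y ** w, x ** w + y ** v) by [].
  rewrite -[cexp _ n.+1]/(cmul _ (cexp _ n)) IH cmulE !cact_amul.
  by rewrite cactBl cactDl !cactM.
rewrite exprS -PQn; have : 'i%C ^+ 2 = -1 :> R[i] := sqr_i R.
move: 'i%C => I I2; transitivity (P * Pn + I * (P * Qn + Q * Pn) + (-1) * (Q * Qn)).
  by ring.
by rewrite -I2; ring.
Qed.

(** Evaluating the stem function on C_J replaces its imaginary unit by [J], which is the map P + i Q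
    of [cexp_cact]. *)
Lemma spow_Phi u w n a :
  spow (Phi J u) (Phi J w) n a = cact J ((cplx u - cplx w) ^+ n) a.
Proof.
rewrite /spow slice_funE//; last 2 first.
- by move=> v; rewrite stem_pow_conj.
- by move=> v; rewrite stem_pow_conj.
have [Pn [Qn [cexpE PQn]]] :=
  cexp_cact (u.1%:C%C - cplx w) u.2%:C%C n.
rewrite /stem_pow PhiE /areal -!(cact_real J).
rewrite -cactBl cexpE /cmul /= !cact_amul !raddf0 addr0 add0r.
have -> : cplx u - cplx w = u.1%:C%C - cplx w + 'i%C * u.2%:C%C.
  rewrite addrAC; congr (_ - _); apply/eqP.
  by rewrite eq_complex /= !(mul0r, mulr0, mul1r, subr0, addr0, add0r) !eqxx.
rewrite -PQn cactDl cactM//; congr (_ + _).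
by rewrite [RHS]/cact /= scale0r add0r scale1r.
Qed.

Lemma Phi_tr u : tr (Phi J u) = areal A (2 * u.1).
Proof.
rewrite /tr /Phi aconjD /areal !aconjZ aconj1 sphere_conj// scalerN addrACA.
by rewrite subrr addr0 -scalerDl mulr_natl mulr2n.
Qed.

Lemma Phi_nm u : nm (Phi J u) = areal A (u.1 ^+ 2 + u.2 ^+ 2).
Proof.
rewrite /nm /Phi aconjD /areal !aconjZ aconj1 sphere_conj//.
rewrite amulDl !amulDr !amulZl !amulZr !amul1l !amul1r amulNr J_sphere.2 opprK.
rewrite !scalerN !scalerA (mulrC u.2 u.1) addrACA addrA.
by rewrite addrK -scalerDl !expr2.
Qed.

Lemma Phi_qcone u : qcone (Phi J u).
Proof.
have [u0|u0] := eqVneq u.2 0.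
  by left; exists u.1; rewrite /Phi u0 scale0r addr0.
right; exists (2 * u.1), (u.1 ^+ 2 + u.2 ^+ 2); rewrite Phi_tr Phi_nm; split=> //.
rewrite exprMn -natrX mulrDr ltrDl mulr_gt0//.
by rewrite exprn_even_gt0.
Qed.

Lemma PhiB u w : Phi J u - Phi J w = Phi J (u - w).
Proof.
by rewrite /Phi /areal !scalerBl opprD addrACA.
Qed.

Lemma sigma_Phi u w : norm_compatible A ->
  sigma (Phi J u) (Phi J w) = normc (cplx u - cplx w).
Proof.
move=> A_norm; rewrite /sigma; case: asboolP => [_|[]]; last first.
  by exists J; split=> //; [exists u|exists w].
by rewrite PhiB (A_norm _ (Phi_qcone _) _ (Phi_nm _)).
Qed.
End SlicePower.

(** * Slices through non-real points, the root test, and the conclusion *)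

(** Completing the square in y^2 = t y - s: v = y - t/2 satisfies v^2 = - d with d = s - t^2/4 > 0,
    so v / sqrt d is an imaginary unit. *)
Lemma qcone_Phi (R : realType) (A : altStarAlgType R) (y : A) :
  qcone y -> ~ is_real y -> exists J w, sphere J /\ y = Phi J w.
Proof.
case=> [//|[t [s [trE nmE ts]]] _].
pose d := s - (t / 2) ^+ 2.
have d0 : 0 < d.
  by rewrite subr_gt0 expr_div_n ltr_pdivrMr ?exprn_gt0// -natrX mulrC.
have ycE : y^c = areal A t - y by rewrite -trE /tr addrC addKr.
have yyE : y ** y = t *: y - areal A s.
  rewrite -nmE /nm ycE amulDr amulNr /areal amulZr amul1r opprB addrC subrK//.
pose v := y - areal A (t / 2).
have vcE : v^c = - v.
  rewrite /v aconjD aconjN ycE /areal aconjZ aconj1 opprB.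
  by rewrite {1}(splitr t) scalerDl addrAC addrK.
have vvE : v ** v = - areal A d.
  rewrite /v /areal amulDl !amulDr !amulNl !amulNr !amulZl !amulZr amul1l.
  rewrite amul1r yyE amul1l opprK scalerA -expr2 /d scalerBl opprB.
  rewrite {1}(splitr t) scalerDl [X in X + _]addrAC [X in X - _ + _]addrK.
  by rewrite addrACA subrr add0r addrC.
have sd0 : Num.sqrt d != 0 by rewrite sqrtr_eq0 -ltNge.
exists ((Num.sqrt d)^-1 *: v), (t / 2, Num.sqrt d); split; last first.
  by rewrite /Phi /= scalerA mulfV// scale1r /v addrC subrK.
have JJ : ((Num.sqrt d)^-1 *: v) ** ((Num.sqrt d)^-1 *: v) = - aone.
  rewrite amulZl amulZr vvE /areal scalerA scalerN scalerA -expr2 exprVn.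
  by rewrite sqr_sqrtr ?ltW// mulVf ?gt_eqF// scale1r.
split=> //; right; exists 0, 1; split.
- by rewrite /tr aconjZ vcE scalerN subrr /areal scale0r.
- by rewrite /nm aconjZ vcE scalerN amulNr JJ opprK /areal scale1r.
- by rewrite expr0n /= mulr1.
Qed.

(** The root test: if 1/r exceeds the upper limit L, then |a_n|^(1/n) <= 1/r for all large n. *)
Lemma sigma_radius_bounded (R : realType) (A : altStarAlgType R) (a : A^nat) :
  (0 < sigma_radius a)%E -> exists r0 : R, [/\ 0 < r0,
    (r0%:E <= sigma_radius a)%E & geometrically_bounded_below r0 a].
Proof.
rewrite /sigma_radius; set L := limn_esup _ => L0.
have L_ge0 : (0 <= L)%E.
  apply: limf_esup_ge0 => [|n]; last by rewrite lee_fin powR_ge0.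
  exact: filter_not_empty.
have bounded (r : R) : 0 < r -> (r%:E < L^-1)%E -> geometrically_bounded r a.
  move=> r_gt0; rewrite inve_pgt ?inE ?lee_fin ?(ltW r_gt0)//.
  rewrite inver gt_eqF// => /ereal_inf_lt[_ [V [N _ NV] <-]] Vr.
  (* The strict inequality excludes n = 0, where the exponent [n%:R^-1] would be 0. *)
  have tail n : (N < n)%N -> `|a n| * r ^+ n <= 1.
    move=> Nn; have n_gt0 : (0 < n)%N by exact: leq_trans Nn.
    have root_le : `|a n| `^ n%:R^-1 <= r^-1.
      rewrite -lee_fin; apply/ltW/(le_lt_trans _ Vr)/ereal_sup_ubound.
      by exists n => //; apply: NV => /=; exact: ltnW.
    rewrite -ler_pdivlMr ?exprn_gt0// mul1r -exprVn.
    have -> : `|a n| = (`|a n| `^ n%:R^-1) ^+ n.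
      rewrite -powR_mulrn ?powR_ge0// -powRrM mulVf ?powRr1//.
      by rewrite pnatr_eq0 -lt0n.
    by rewrite lerXn2r ?nnegrE ?powR_ge0// invr_ge0 ltW.
  (* The sum accounts for the finitely many terms outside the tail. *)
  exists (1 + \sum_(0 <= i < N.+1) `|a i| * r ^+ i) => n.
  have term_ge0 i : 0 <= `|a i| * r ^+ i by rewrite mulr_ge0// exprn_ge0// ltW.
  have [nN|Nn] := leqP n N; last by rewrite ler_wpDr ?tail ?sumr_ge0.
  rewrite ler_wpDl// big_mkord (bigD1 (Ordinal (nN : (n < N.+1)%N)))//=.
  by rewrite lerDl sumr_ge0.
(* [r0] must be a real number; for an infinite radius any positive value serves. *)
exists (if (L^-1 == +oo)%E then 1 else fine (L^-1)%E : R).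
have [Loo|Lnoo] := eqVneq (L^-1)%E (+oo)%E.
  split=> // [|r /andP[r0 _]]; first by rewrite Loo leey.
  by apply: bounded => //; rewrite Loo ltry.
have Lfin : (L^-1)%E \is a fin_num by rewrite gt0_fin_numE// ltey.
split; [by rewrite fine_gt0// L0 ltey|by rewrite fineK|].
by move=> r /andP[r0 rL]; apply: bounded => //; rewrite -(fineK Lfin) lte_fin.
Qed.

Theorem proposition3p6 (R : realType) (A : altStarAlgType R)
    (A_norm : norm_compatible A) (A_sphere : @sphere R A !=set0)
    (y : A) (y_cone : qcone y) (y_nreal : ~ is_real y)
    (a : nat -> A) (radius_gt0 : (0 < sigma_radius a)%E)
    (P : A -> A)
    (P_sum : forall x, sigma_ball y (sigma_radius a) x ->
       series (fun n => spow x y n (a n)) @ \oo --> P x) :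
  forall n : nat, cullen_derivable n P y /\
    a n = (n`!%:R : R)^-1 *: cullen_derive n P y.
Proof.
have [r0 [r0_gt0 r0_le bnd]] := sigma_radius_bounded radius_gt0.
(* This holds for either pair (J, w) representing y, as both [cullen_derivable] and [cullen_derive]
   demand. *)
have P_csum J w : sphere J -> y = Phi J w -> forall u,
    normc (cplx u - cplx w) < r0 -> (P \o Phi J) u = csum J a (cplx u - cplx w).
  move=> sJ yE u ur0; have /P_sum : sigma_ball y (sigma_radius a) (Phi J u).
    split; first exact: Phi_qcone.
    by rewrite yE sigma_Phi// (lt_le_trans _ r0_le)// lte_fin.
  move=> /(cvg_lim (@norm_hausdorff _ _)) /= <-; rewrite /csum /cseries yE.
  by congr (limn (series _)); apply/funext => n; rewrite spow_Phi.
move=> n; split.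
  move=> J w sJ yE.
  have [|//] := dzn_csum sJ n bnd (P_csum J w sJ yE) (u := w).
  by rewrite subrr normc0.
(* Every candidate value is n! a_n, so the choice is harmless; [qcone_Phi] provides a candidate and
   rules out the default 0. *)
rewrite /cullen_derive; case: xgetP => [v _ [J [w [sJ yE ->]]]|no].
  rewrite (dzn_csum_center sJ n r0_gt0 bnd (P_csum J w sJ yE) (erefl _)).
  by rewrite scalerA mulVf ?scale1r// pnatr_eq0 -lt0n fact_gt0.
have [J [w [sJ yE]]] := qcone_Phi y_cone y_nreal.
by case: (no (dzn J n (P \o Phi J) w)); exists J, w.
Qed.
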